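(* (1) $\mathbf{K_N^{Krom,\Diamond}}\equiv\mathbf{K_N^{Krom}}$; (2) $\mathbf{K_N^{Krom,\Diamond}}\prec^w\mathbf{K_N^{Krom}}$.
   Context: Fix a finite set $\tau$ of modality labels and a countable set $\mathcal P$ of propositional letters. Formulas of $\mathbf{K_N}$ are generated by $\varphi ::= \top \mid p \mid \neg\varphi \mid \varphi\vee\varphi \mid \Diamond_\alpha\varphi \mid \Box_\alpha\varphi$; $\wedge,\rightarrow$ are abbreviations, $\bot=\neg\top$. Models $M=(\mathcal F,V)$ with frame $\mathcal F=(W,\{R_\alpha\}_{\alpha\in\tau})$, $W\neq\emptyset$, $R_\alpha\subseteq W\times W$, $V:W\to2^{\mathcal P}$, standard Kripke semantics. Positive literals: $\lambda ::= \top \mid p \mid \Diamond_\alpha\lambda \mid \Box_\alpha\lambda$. Clausal form: $\varphi ::= \lambda \mid \neg\lambda \mid \nabla(\neg\lambda_1\vee\dots\vee\neg\lambda_n\vee\lambda_{n+1}\vee\dots\vee\lambda_{n+m}) \mid \varphi\wedge\varphi$, with positive literals $\lambda,\lambda_i$ and $\nabla$ a finite (possibly empty) sequence of boxes. $\mathbf{K_N^{Krom}}$: every clause has $n+m\le2$. $\mathbf{K_N^{Krom,\Diamond}}$ is the subfragment of $\mathbf{K_N^{Krom}}$ in which positive literals contain no boxes ($\lambda::=\top\mid p\mid\Diamond_\alpha\lambda$; box prefixes $\nabla$ still allowed). Expressivity (over all Kripke frames). Weak: $\mathbf L\preceq^w\mathbf L'$ if for a fixed alphabet $\mathcal P$ there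 is an effective translation $\varphi\mapsto\varphi'$ from $\mathbf L$-formulas to $\mathbf L'$-formulas over the same $\mathcal P$ with $M,w\Vdash\varphi$ iff $M,w\Vdash\varphi'$ for all $M,w$. Strong: for a model $M=(\mathcal F,V)$ over $\mathcal P$ and $\mathcal P'\supseteq\mathcal P$, an extension of $M$ is a model $(\mathcal F,V')$ over $\mathcal P'$ with $V'$ agreeing with $V$ on $\mathcal P$; $\mathbf L\preceq\mathbf L'$ if there is an effective translation taking each $\mathbf L$-formula $\varphi$ over $\mathcal P$ to an $\mathbf L'$-formula $\varphi'$ over some $\mathcal P'\supseteq\mathcal P$ (finitely many new letters) such that for all $M$ over $\mathcal P$ and $w$: $M,w\Vdash\varphi$ iff some extension $M'$ of $M$ has $M',w\Vdash\varphi'$. $\equiv$ (resp. $\equiv^w$) means $\preceq$ (resp. $\preceq^w$) in both directions; $\mathbf L\prec^w\mathbf L'$ means $\mathbf L\preceq^w\mathbf L'$ and not $\mathbf L\equiv^w\mathbf L'$. *)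

(* Defs.v *)
From mathcomp Require Import all_boot.
Set Implicit Arguments.
Unset Strict Implicit.
Unset Printing Implicit Defensive.

Inductive form (tau P : Type) : Type :=
| Top
| Var of P
| Neg of form tau P
| Or of form tau P & form tau P
| Dia of tau & form tau P
| Box of tau & form tau P.

Arguments Top {tau P}.
Arguments Var {tau P} p.

Definition Bot {tau P : Type} : form tau P := Neg Top.

Definition And {tau P : Type} (f g : form tau P) : form tau P :=
  Neg (Or (Neg f) (Neg g)).

Record frame (tau : Type) : Type := Frame {
  world :> Type;
  world_nonempty : inhabited world;
  acc : tau -> world -> world -> Prop
}.

Definition valuation (tau : Type) (F : frame tau) (P : Type) : Type :=
  F -> P -> Prop.

Fixpoint sat (tau P : Type) (F : frame tau) (V : valuation F P) (w : F)
    (f : form tau P) : Prop :=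
  match f with
  | Top => True
  | Var p => V w p
  | Neg g => ~ sat V w g
  | Or g h => sat V w g \/ sat V w h
  | Dia a g => exists v : F, acc a w v /\ sat V v g
  | Box a g => forall v : F, acc a w v -> sat V v g
  end.

Fixpoint pos_lit (tau P : Type) (f : form tau P) : bool :=
  match f with
  | Top | Var _ => true
  | Dia _ g | Box _ g => pos_lit g
  | Neg _ | Or _ _ => false
  end.

Fixpoint dia_lit (tau P : Type) (f : form tau P) : bool :=
  match f with
  | Top | Var _ => true
  | Dia _ g => dia_lit g
  | Box _ _ | Neg _ | Or _ _ => false
  end.

(* The empty disjunction is Bot, i.e. the clause with single literal ~ Top. *)
Fixpoint disj (tau P : Type) (s : seq (form tau P)) : form tau P :=
  match s with
  | [::] => Bot
  | [:: f] => f
  | f :: s' => Or f (disj s')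
  end.

Definition boxes (tau P : Type) (nabla : seq tau) (f : form tau P) :
  form tau P := foldr (@Box tau P) f nabla.

(* The Krom clausal forms whose positive literals satisfy [lit]; in a clause,
   [ns] lists the literals occurring negated and [ps] the others. *)
Inductive krom_over (tau P : Type) (lit : form tau P -> bool) :
    form tau P -> Prop :=
| krom_pos l : lit l -> krom_over lit l
| krom_neg l : lit l -> krom_over lit (Neg l)
| krom_clause (nabla : seq tau) (ns ps : seq (form tau P)) :
    all lit ns -> all lit ps -> size ns + size ps <= 2 ->
    krom_over lit (boxes nabla (disj (map (@Neg tau P) ns ++ ps)))
| krom_and f g :
    krom_over lit f -> krom_over lit g -> krom_over lit (And f g).

Definition language (tau : Type) : Type :=
  forall P : Type, form tau P -> Prop.

Definition krom (tau : Type) : language tau :=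
  fun P => krom_over (@pos_lit tau P).

Definition krom_dia (tau : Type) : language tau :=
  fun P => krom_over (@dia_lit tau P).

(* Computability is that of the partial recursive functions on binary trees:
   they contain the constructor and the destructors and are closed under
   pairing, composition, case distinction, structural recursion and unbounded
   iteration.  Structural recursion is redundant, as primitive recursion on
   numbers is for WHILE programs; it is there for convenience. *)
Inductive tree : Type := Leaf | Node of tree & tree.

Inductive prog : Type :=
| PId
| PLeaf
| PFst
| PSnd
| PNode of prog & prog
| PComp of prog & prog
| PIf of prog & prog & prog
| PRec of prog & prog
| PWhile of prog & prog.

(* [eval p x y]: program p halts on input x with output y.
   [PComp p q] runs p first; [PIf] and [PWhile] read Leaf as false;
   [PRec p q] recurses on the right component of its input, the left component
   being a parameter. *)
Inductive eval : prog -> tree -> tree -> Prop :=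
| eval_id x : eval PId x x
| eval_leaf x : eval PLeaf x Leaf
| eval_fst0 : eval PFst Leaf Leaf
| eval_fst x y : eval PFst (Node x y) x
| eval_snd0 : eval PSnd Leaf Leaf
| eval_snd x y : eval PSnd (Node x y) y
| eval_node p q x y z :
    eval p x y -> eval q x z -> eval (PNode p q) x (Node y z)
| eval_comp p q x y z :
    eval p x y -> eval q y z -> eval (PComp p q) x z
| eval_if_true c p q x u v y :
    eval c x (Node u v) -> eval p x y -> eval (PIf c p q) x y
| eval_if_false c p q x y :
    eval c x Leaf -> eval q x y -> eval (PIf c p q) x y
| eval_rec_leaf p q e y :
    eval p e y -> eval (PRec p q) (Node e Leaf) y
| eval_rec_node p q e a b ya yb y :
    eval (PRec p q) (Node e a) ya -> eval (PRec p q) (Node e b) yb ->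
    eval q (Node (Node e (Node a b)) (Node ya yb)) y ->
    eval (PRec p q) (Node e (Node a b)) y
| eval_while_stop c p x :
    eval c x Leaf -> eval (PWhile c p) x x
| eval_while_step c p x u v y z :
    eval c x (Node u v) -> eval p x y -> eval (PWhile c p) y z ->
    eval (PWhile c p) x z.

Definition code_nat (n : nat) : tree := iter n (Node Leaf) Leaf.

Definition code_letter (P : countType) (p : P) : tree := code_nat (pickle p).

Definition code_letter_ext (P : countType) (k : nat) (x : P + 'I_k) : tree :=
  match x with
  | inl p => Node (code_nat 0) (code_letter p)
  | inr i => Node (code_nat 1) (code_nat i)
  end.

Fixpoint code_form (tau : finType) (P : Type) (c : P -> tree)
    (f : form tau P) : tree :=
  match f with
  | Top => Node (code_nat 0) Leaf
  | Var p => Node (code_nat 1) (c p)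
  | Neg g => Node (code_nat 2) (code_form c g)
  | Or g h => Node (code_nat 3) (Node (code_form c g) (code_form c h))
  | Dia a g => Node (code_nat 4) (Node (code_nat (pickle a)) (code_form c g))
  | Box a g => Node (code_nat 5) (Node (code_nat (pickle a)) (code_form c g))
  end.

(* [t f] is the code of the image of [f]; outside [L] nothing is required. *)
Definition effective (tau : finType) (P : countType) (L : language tau)
    (t : form tau P -> tree) : Prop :=
  exists p : prog, forall f : form tau P,
    L P f -> eval p (code_form (@code_letter P) f) (t f).

Definition weak_le (tau : finType) (P : countType) (L L' : language tau) :
    Prop :=
  exists t : form tau P -> form tau P,
    [/\ effective L (fun f => code_form (@code_letter P) (t f)),
        forall f, L P f -> L' P (t f) &
        forall f, L P f ->
          forall (F : frame tau) (V : valuation F P) (w : F),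
            sat V w f <-> sat V w (t f)].

Definition weak_equiv (tau : finType) (P : countType) (L L' : language tau) :
    Prop :=
  weak_le P L L' /\ weak_le P L' L.

Definition weak_lt (tau : finType) (P : countType) (L L' : language tau) :
    Prop :=
  weak_le P L L' /\ ~ weak_equiv P L L'.

Definition extends (tau P Q : Type) (F : frame tau) (V : valuation F P)
    (V' : valuation F (P + Q)) : Prop :=
  forall (w : F) (p : P), V' w (inl p) <-> V w p.

(* The alphabet of the translation [t f] is P together with [k f] new
   letters. *)
Definition strong_le (tau : finType) (P : countType) (L L' : language tau) :
    Prop :=
  exists (k : form tau P -> nat)
         (t : forall f : form tau P, form tau (P + 'I_(k f))),
    [/\ effective L (fun f => code_form (@code_letter_ext P (k f)) (t f)),
        forall f, L P f -> L' (P + 'I_(k f))%type (t f) &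
        forall f, L P f ->
          forall (F : frame tau) (V : valuation F P) (w : F),
            sat V w f <->
            exists V' : valuation F (P + 'I_(k f)),
              extends V V' /\ sat V' w (t f)].

Definition strong_equiv (tau : finType) (P : countType)
    (L L' : language tau) : Prop :=
  strong_le P L L' /\ strong_le P L' L.

(* Main.v *)
Require Import Defs.
From mathcomp Require Import all_boot.
From Stdlib Require Import Classical.

Set Implicit Arguments.
Unset Strict Implicit.
Unset Printing Implicit Defensive.

(** Strong equivalence: a fresh letter [x_g] names each formula [g].  For every
    [g] free of disjunctions, finitely many Krom clauses with diamond literals
    force [x_g] to have the truth value of [g]; the box needs the equivalence
    [Box a g <-> ~ Dia a (~ g)], available because [~ g] has a name of its own.
    A Krom formula then becomes a conjunction of binary clauses between names.

    Strictness of the weak order: let [w] see only a reflexive world [v] making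
    every letter true, and add as a second successor of [w] a dead end where all
    letters are false.  Diamond literals have the same values at [w] and at [v]
    before and after the addition, whereas [~ Box a (Dia a Top)] becomes true at
    [w]. *)

(** * Computable functions on trees *)

Definition computable (f : tree -> tree) : Prop :=
  exists p, forall x, eval p x (f x).

Definition tfst (t : tree) : tree := if t is Node a _ then a else Leaf.
Definition tsnd (t : tree) : tree := if t is Node _ b then b else Leaf.
Definition tif (c p q : tree) : tree := if c is Node _ _ then p else q.

(** Functional counterpart of [PRec]. The input [x] of [step] packs parameter, current node and both
    recursive results: [tsnd (tfst x)] is the node, while [tfst (tsnd x)] and [tsnd (tsnd x)] are
    the results on its children. *)
Fixpoint trec (base step : tree -> tree) (e t : tree) : tree :=
  if t is Node a b then
    step (Node (Node e t) (Node (trec base step e a) (trec base step e b)))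
  else base e.

Lemma computable_id : computable id.
Proof. by exists PId => x; constructor. Qed.

Lemma computable_Node f g :
  computable f -> computable g -> computable (fun x => Node (f x) (g x)).
Proof. by move=> [p fP] [q gP]; exists (PNode p q) => x; constructor. Qed.

Lemma computable_const t : computable (fun _ => t).
Proof.
elim: t => [|a IHa b IHb]; last exact: computable_Node.
by exists PLeaf => x; constructor.
Qed.

Lemma computable_comp g f :
  computable g -> computable f -> computable (fun x => g (f x)).
Proof.
by move=> [q gP] [p fP]; exists (PComp p q) => x; apply: eval_comp (gP _).
Qed.

Lemma computable_fst f : computable f -> computable (fun x => tfst (f x)).
Proof.
apply: computable_comp; exists PFst.
by case=> [|a b]; constructor.
Qed.

Lemma computable_snd f : computable f -> computable (fun x => tsnd (f x)).
Proof.
apply: computable_comp; exists PSnd.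
by case=> [|a b]; constructor.
Qed.

Lemma computable_if c f g :
  computable c -> computable f -> computable g ->
  computable (fun x => tif (c x) (f x) (g x)).
Proof.
move=> [r cP] [p fP] [q gP]; exists (PIf r p q) => x.
case E: (c x) (cP x) => [|u v] cPx; first exact: eval_if_false.
exact: eval_if_true cPx _.
Qed.

Lemma computable_rec base step e f :
  computable base -> computable step -> computable e -> computable f ->
  computable (fun x => trec base step (e x) (f x)).
Proof.
move=> [p baseP] [q stepP] [r eP] [s fP].
exists (PComp (PNode r s) (PRec p q)) => x.
apply: (@eval_comp _ _ _ (Node (e x) (f x))); first by constructor.
elim: (f x) => [|a IHa b IHb]; first exact: eval_rec_leaf.
exact: eval_rec_node IHa IHb (stepP _).
Qed.

Ltac computability_step :=
  first
    [ assumption | apply: computable_id | apply: computable_const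
    | apply: computable_Node | apply: computable_fst | apply: computable_snd
    | apply: computable_if ].

Ltac computability := repeat computability_step.

(** * Unary arithmetic and list concatenation on trees *)

Definition tdouble : tree -> tree :=
  trec id (fun x => Node Leaf (Node Leaf (tsnd (tsnd x)))) Leaf.

Definition tpow_mul (m n : tree) : tree :=
  trec id (fun x => tdouble (tsnd (tsnd x))) n m.

Definition tindex : tree -> tree :=
  trec id (fun x => tpow_mul (tfst (tsnd x)) (Node Leaf (tdouble (tsnd (tsnd x)))))
    Leaf.

Definition tcat (s t : tree) : tree :=
  trec id (fun x => Node (tfst (tsnd (tfst x))) (tsnd (tsnd x))) t s.

Lemma computable_double f : computable f -> computable (fun x => tdouble (f x)).
Proof. by move=> fP; apply: computable_rec; computability. Qed.

Lemma computable_pow_mul f g :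
  computable f -> computable g -> computable (fun x => tpow_mul (f x) (g x)).
Proof.
move=> fP gP; apply: computable_rec; computability.
by apply: computable_double; computability.
Qed.

Lemma computable_index f : computable f -> computable (fun x => tindex (f x)).
Proof.
move=> fP; apply: computable_rec; computability.
apply: computable_pow_mul; computability.
by apply: computable_double; computability.
Qed.

Lemma computable_cat f g :
  computable f -> computable g -> computable (fun x => tcat (f x) (g x)).
Proof. by move=> fP gP; apply: computable_rec; computability. Qed.

(** * Numbering trees *)

(** The pairing [2 ^ m * (2 n + 1)], iterated along the tree; its values are positive, which leaves
    0 for [Leaf]. It turns codes of formulas into numbers of letters, and [tindex] computes it in
    unary. *)
Fixpoint tree_index (t : tree) : nat :=
  if t is Node a b then 2 ^ tree_index a * (tree_index b).*2.+1 else 0.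

Lemma tree_index_inj : injective tree_index.
Proof.
have pair_inj m n m' n' :
    2 ^ m * n.*2.+1 = 2 ^ m' * n'.*2.+1 -> m = m' /\ n = n'.
  rewrite -[n]CodeSeq.decodeK -[n']CodeSeq.decodeK => eq_mn.
  (* [CodeSeq.code] adds a head to a list by this same pairing, so its injectivity on lists yields
     that of the pairing. *)
  have /(can_inj CodeSeq.codeK) [-> ->] //:
    CodeSeq.code (m :: CodeSeq.decode n) = CodeSeq.code (m' :: CodeSeq.decode n').
  exact: eq_mn.
have pair_gt0 m n : 0 < 2 ^ m * n.*2.+1 by rewrite muln_gt0 expn_gt0.
elim=> [|a IHa b IHb] [|a' b'] //=.
- by move=> eq0; have := pair_gt0 (tree_index a') (tree_index b'); rewrite -eq0.
- by move=> eq0; have := pair_gt0 (tree_index a) (tree_index b); rewrite eq0.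
by case/pair_inj => /IHa-> /IHb->.
Qed.

Lemma tdoubleE n : tdouble (code_nat n) = code_nat n.*2.
Proof. by rewrite /tdouble; elim: n => //= n ->. Qed.

Lemma tpow_mulE m n : tpow_mul (code_nat m) (code_nat n) = code_nat (2 ^ m * n).
Proof.
rewrite /tpow_mul; elim: m => [|m IHm] /=; first by rewrite mul1n.
by rewrite IHm tdoubleE -mul2n mulnA -expnS.
Qed.

Lemma tindexE t : tindex t = code_nat (tree_index t).
Proof.
rewrite /tindex; elim: t => //= a -> b ->.
by rewrite tdoubleE -tpow_mulE.
Qed.

Lemma code_nat_inj : injective code_nat.
Proof. by elim=> [|m IHm] [|n] //= [/IHm->]. Qed.

Lemma code_form_inj (tau : finType) (P : Type) (c : P -> tree) :
  injective c -> injective (@code_form tau P c).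
Proof.
move=> c_inj; elim=> [|p|f IHf|f IHf g IHg|a f IHf|a f IHf]
  [|p'|f'|f' g'|a' f'|a' f'] //=.
- by case=> /c_inj->.
- by case=> /IHf->.
- by case=> /IHf-> /IHg->.
- by case=> /code_nat_inj/(pcan_inj pickleK)-> /IHf->.
- by case=> /code_nat_inj/(pcan_inj pickleK)-> /IHf->.
Qed.

(** * Conjunctions of clauses *)

Fixpoint All (T : Type) (A : T -> Prop) (s : seq T) : Prop :=
  if s is x :: s' then A x /\ All A s' else True.

Lemma All_cat (T : Type) (A : T -> Prop) (s t : seq T) :
  All A (s ++ t) <-> All A s /\ All A t.
Proof. by elim: s => /= [|x s IHs]; tauto. Qed.

Definition conjunction (tau P : Type) (cs : seq (form tau P)) : form tau P :=
  foldr And Top cs.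

(** An equivalence and a complementarity each cost two binary clauses, so both stay within the Krom
    restriction. *)
Definition iff_clauses (tau P : Type) (f g : form tau P) :=
  [:: Or (Neg f) g; Or (Neg g) f].

Definition xor_clauses (tau P : Type) (f g : form tau P) :=
  [:: Or (Neg f) (Neg g); Or f g].

Section SatAll.

Variables (tau P : Type) (F : frame tau) (V : valuation F P).
Implicit Types (w : F) (f g : form tau P) (cs : seq (form tau P)).

Lemma sat_And w f g : sat V w (And f g) <-> sat V w f /\ sat V w g.
Proof.
rewrite /=; split=> [nfg|[Vf Vg] [] //].
by split; apply: NNPP => nf; apply: nfg; [left|right].
Qed.

Lemma sat_conj w cs : sat V w (conjunction cs) <-> All (sat V w) cs.
Proof.
elim: cs => // c cs IHcs; rewrite [All _ _]/=.
by split=> [/sat_And[? /IHcs]|[? /IHcs ?]] //; apply/sat_And.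
Qed.

Lemma sat_all_Box w a cs :
  All (sat V w) (map (Box a) cs) <-> forall v, acc a w v -> All (sat V v) cs.
Proof.
elim: cs => //= c cs IHcs; split=> [[Vc /IHcs Vcs] v wv|Vcs].
  by split; [apply: Vc|apply: Vcs].
by split; [|apply/IHcs] => v /Vcs[].
Qed.

Lemma sat_iff_clauses w f g :
  All (sat V w) (iff_clauses f g) <-> (sat V w f <-> sat V w g).
Proof.
by rewrite /=; have := classic (sat V w f); have := classic (sat V w g); tauto.
Qed.

Lemma sat_xor_clauses w f g :
  All (sat V w) (xor_clauses f g) <-> (sat V w f <-> ~ sat V w g).
Proof.
by rewrite /=; have := classic (sat V w f); have := classic (sat V w g); tauto.
Qed.

End SatAll.

Section Clauses.

Variables (tau P : Type).
Implicit Types (l m c : form tau P) (cs : seq (form tau P)).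

(** The box prefix grows one box at a time, which suits inductions on formulas; [krom_dia_clause]
    gathers it into a single prefix. *)
Inductive clause : form tau P -> Prop :=
| clause_disj ns ps :
    all (@dia_lit tau P) ns -> all (@dia_lit tau P) ps ->
    size ns + size ps <= 2 -> clause (disj (map (@Neg tau P) ns ++ ps))
| clause_Box a c : clause c -> clause (Box a c).

Lemma clause_pos l : dia_lit l -> clause l.
Proof. by move=> ll; apply: (@clause_disj [::] [:: l]); rewrite //= ll. Qed.

Lemma clause_neg l : dia_lit l -> clause (Neg l).
Proof. by move=> ll; apply: (@clause_disj [:: l] [::]); rewrite //= ll. Qed.

Lemma clause_or l m : dia_lit l -> dia_lit m -> clause (Or l m).
Proof. by move=> ll lm; apply: (@clause_disj [::] [:: l; m]); rewrite //= ll lm. Qed.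

Lemma clauses_iff l m :
  dia_lit l -> dia_lit m -> All clause (iff_clauses l m).
Proof.
move=> ll lm; split; last split=> //.
  by apply: (@clause_disj [:: l] [:: m]); rewrite //= ?ll ?lm.
by apply: (@clause_disj [:: m] [:: l]); rewrite //= ?ll ?lm.
Qed.

Lemma clauses_xor l m :
  dia_lit l -> dia_lit m -> All clause (xor_clauses l m).
Proof.
move=> ll lm; split; last by split=> //; apply: clause_or.
by apply: (@clause_disj [:: l; m] [::]); rewrite //= ll lm.
Qed.

Lemma clauses_Box a cs : All clause cs -> All clause (map (Box a) cs).
Proof.
by elim: cs => //= c cs IHcs [cP /IHcs]; split=> //; apply: clause_Box.
Qed.

Lemma krom_dia_clause c : clause c -> krom_dia c.
Proof.
move=> cP; suff [nabla [ns [ps [nsP psP sz ->]]]] : exists nabla ns ps,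
    [/\ all (@dia_lit tau P) ns, all (@dia_lit tau P) ps, size ns + size ps <= 2
      & c = boxes nabla (disj (map (@Neg tau P) ns ++ ps))].
  exact: krom_clause.
elim: cP => [ns ps nsP psP sz|a d _ [nabla [ns [ps [nsP psP sz ->]]]]].
  by exists [::], ns, ps.
by exists (a :: nabla), ns, ps.
Qed.

Lemma krom_dia_conj cs : All clause cs -> krom_dia (conjunction cs).
Proof.
elim: cs => [_|c cs IHcs [/krom_dia_clause cP /IHcs]]; first exact: krom_pos.
exact: krom_and.
Qed.

End Clauses.

Lemma krom_dia_krom (tau P : Type) (f : form tau P) : krom_dia f -> krom f.
Proof.
have dia_pos (l : form tau P) : dia_lit l -> pos_lit l by elim: l.
elim=> [l /dia_pos|l /dia_pos|nabla ns ps nsP psP sz|g h _ gP _ hP].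
- exact: krom_pos.
- exact: krom_neg.
- by apply: krom_clause => //; [apply: sub_all nsP|apply: sub_all psP].
- exact: krom_and.
Qed.

(** * The translation *)

Section Translation.

Variables (tau : finType) (P : countType).
Implicit Types f g h : form tau P.

Definition form_index f : nat := tree_index (code_form (@code_letter P) f).

Definition name f : form tau (P + nat) := Var (inr (form_index f)).

Lemma form_index_inj : injective form_index.
Proof.
apply: inj_comp tree_index_inj _; apply: code_form_inj.
by apply: inj_comp code_nat_inj (pcan_inj pickleK).
Qed.

(** Under a modality [a] the clauses for [g] are boxed by [a]: the name of [f] at a world depends on
    the name of [g] at the [a]-successors only. *)
Fixpoint definition_of f : seq (form tau (P + nat)) :=
  match f with
  | Top => [:: name f]
  | Var p => iff_clauses (name f) (Var (inl p))
  | Neg g => definition_of g ++ xor_clauses (name f) (name g)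
  | Or _ _ => [::]
  | Dia a g =>
      map (Box a) (definition_of g) ++ iff_clauses (name f) (Dia a (name g))
  | Box a g =>
      map (Box a) (definition_of g ++ xor_clauses (name (Neg g)) (name g)) ++
      xor_clauses (name f) (Dia a (name (Neg g)))
  end.

(* [assertion true f] asserts f and [assertion false f] asserts ~ f. *)
Fixpoint assertion (b : bool) f : seq (form tau (P + nat)) :=
  match f with
  | Neg g => assertion (~~ b) g
  | Or g h =>
      if b then Or (name g) (name h) :: definition_of g ++ definition_of h
      else assertion false g ++ assertion false h
  | Box a g =>
      if b then map (Box a) (assertion true g)
      else Neg (name f) :: definition_of f
  | _ => (if b then name f else Neg (name f)) :: definition_of f
  end.

Lemma clauses_definition f : All (@clause tau (P + nat)) (definition_of f).
Proof.
elim: f => [|p|g IHg|g _ h _|a g IHg|a g IHg] //=.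
- by split=> //; apply: clause_pos.
- exact: clauses_iff.
- by apply/All_cat; split=> //; apply: clauses_xor.
- by apply/All_cat; split; [apply: clauses_Box|apply: clauses_iff].
- apply/All_cat; split; last exact: clauses_xor.
  by apply: clauses_Box; apply/All_cat; split=> //; apply: clauses_xor.
Qed.

Lemma clauses_assertion b f : All (@clause tau (P + nat)) (assertion b f).
Proof.
have atom c g : All (@clause tau (P + nat))
    ((if c then name g else Neg (name g)) :: definition_of g).
  split; last exact: clauses_definition.
  by case: c; [apply: clause_pos|apply: clause_neg].
elim: f b => [|p|g IHg|g IHg h IHh|a g IHg|a g IHg] b; try exact: atom.
- exact: IHg.
- case: b => /=; last by apply/All_cat.
  split; first exact: clause_or.
  by apply/All_cat; split; apply: clauses_definition.
- by case: b => /=; [apply: clauses_Box|apply: (atom false)].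
Qed.

(** * Correctness of the naming clauses *)

Section Semantics.

Variables (F : frame tau) (V : valuation F P).

(** The intended extension. Injectivity of [form_index] keeps a number from naming two formulas; a
    number that indexes no formula is false everywhere. *)
Definition naming_valuation : valuation F (P + nat) := fun w q =>
  match q with
  | inl p => V w p
  | inr n => exists2 f, n = form_index f & sat V w f
  end.

Lemma sat_name w f : sat naming_valuation w (name f) <-> sat V w f.
Proof. by split=> [[g /form_index_inj<-]|Vf] //; exists f. Qed.

Lemma sat_Box_dual w a f : sat V w (Box a f) <-> ~ sat V w (Dia a (Neg f)).
Proof.
split=> [Vf [v [wv]]|nVf v wv]; first by apply; apply: Vf.
by apply: NNPP => nf; apply: nVf; exists v.
Qed.

Lemma naming_definition w f : All (sat naming_valuation w) (definition_of f).
Proof.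
have Dia_name u a g :
    sat naming_valuation u (Dia a (name g)) <-> sat V u (Dia a g).
  by split=> -[v [uv /sat_name ?]]; exists v.
elim: f w => [|p|g IHg|g _ h _|a g IHg|a g IHg] w //.
- by split=> //; apply/sat_name.
- exact/sat_iff_clauses/sat_name.
- apply/All_cat; split=> //; apply/sat_xor_clauses.
  by rewrite !sat_name.
- apply/All_cat; split; first by apply/sat_all_Box.
  by apply/sat_iff_clauses; rewrite sat_name Dia_name.
- apply/All_cat; split; last first.
    by apply/sat_xor_clauses; rewrite sat_name Dia_name sat_Box_dual.
  apply/sat_all_Box => v _; apply/All_cat; split=> //.
  by apply/sat_xor_clauses; rewrite !sat_name.
Qed.

Lemma naming_assertion w b f :
  (if b then sat V w f else ~ sat V w f) ->
  All (sat naming_valuation w) (assertion b f).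
Proof.
have atom u c g : (if c then sat V u g else ~ sat V u g) ->
    All (sat naming_valuation u)
      ((if c then name g else Neg (name g)) :: definition_of g).
  move=> Vg; split; last exact: naming_definition.
  by case: c Vg => [|nVg /sat_name] //; move/sat_name.
elim: f w b => [|p|g IHg|g IHg h IHh|a g IHg|a g IHg] w b Vf; try exact: atom.
- by apply: IHg; case: b Vf => //=; apply: NNPP.
- case: b Vf => /= Vf.
    split; first by case: Vf => /sat_name; [left|right].
    by apply/All_cat; split; apply: naming_definition.
  by apply/All_cat; split; [apply: IHg|apply: IHh]; tauto.
- case: b Vf => Vf; last exact: (atom w false (Box a g)).
  by apply/sat_all_Box => v /Vf; apply: (IHg v true).
Qed.

Fixpoint or_free f : bool :=
  match f with
  | Top | Var _ => true
  | Neg g | Dia _ g | Box _ g => or_free g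
  | Or _ _ => false
  end.

(** The polarity [b] is tracked because [And] is a negated disjunction: a negative [Or] is a
    conjunction and is split, whereas a positive [Or] becomes a clause between two names, whose
    formulas must be free of disjunctions. *)
Fixpoint translatable (b : bool) f : bool :=
  match f with
  | Neg g => translatable (~~ b) g
  | Or g h =>
      if b then or_free g && or_free h
      else translatable false g && translatable false h
  | Box a g => if b then translatable true g else or_free g
  | _ => or_free f
  end.

Variable V' : valuation F (P + nat).
Hypothesis VV' : extends V V'.

(** [V'] is any extension of [V], so the clauses alone fix the names. The induction covers all
    worlds, since the boxed clauses supply the definition of [g] at each successor. *)
Lemma definition_sound w f :
  or_free f -> All (sat V' w) (definition_of f) ->
  (sat V' w (name f) <-> sat V w f).
Proof.
elim: f w => [|p|g IHg|//|a g IHg|a g IHg] w fP.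
- by case.
- by move/sat_iff_clauses=> ->; apply: VV'.
- case/All_cat=> /(IHg _ fP) Vg /sat_xor_clauses ->.
  by rewrite Vg.
- case/All_cat=> /sat_all_Box Vg /sat_iff_clauses ->.
  by split=> -[v [wv Vv]]; exists v; split=> //; apply/(IHg v fP (Vg v wv)).
- case/All_cat=> /sat_all_Box Vg /sat_xor_clauses ->.
  (* At a successor [v], the boxed clauses make the name of [Neg g] true exactly when [g] fails, so
     the two diamonds have the same witnesses. *)
  rewrite sat_Box_dual; split=> nD [v [wv Vv]]; apply: nD; exists v; split=> //;
    have /All_cat[/(IHg _ fP) gE /sat_xor_clauses ngE] := Vg v wv.
  + by apply/ngE; rewrite gE.
  + by move/ngE: Vv; rewrite gE.
Qed.

Lemma assertion_sound w b f :
  translatable b f -> All (sat V' w) (assertion b f) ->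
  if b then sat V w f else ~ sat V w f.
Proof.
have atom u c g : or_free g -> All (sat V' u)
      ((if c then name g else Neg (name g)) :: definition_of g) ->
    if c then sat V u g else ~ sat V u g.
  move=> gP [Vg /(definition_sound gP) gE].
  by case: c Vg => Vg; rewrite -gE.
elim: f w b => [|p|g IHg|g IHg h IHh|a g IHg|a g IHg] w b fP; try exact: atom.
- by move=> /(IHg _ _ fP); case: b {fP} => //= Vg; apply.
- case: b fP => /= /andP[gP hP].
    by case=> Vgh /All_cat[/(definition_sound gP)<- /(definition_sound hP)<-].
  by case/All_cat=> /(IHg _ _ gP) nVg /(IHh _ _ hP) nVh [].
- case: b fP => fP; last exact: (atom w false (Box a g)).
  by move/sat_all_Box=> Vg v /Vg; apply: (IHg v true).
Qed.

End Semantics.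

Lemma or_free_translatable b f : or_free f -> translatable b f.
Proof. by elim: f b => //= [g IHg|a g IHg] [] //; apply: IHg. Qed.

(** With at most two literals a clause contains at most one [Or], and its box prefix keeps the
    polarity positive; the conjuncts of [And] sit under two negations and become positive again. *)
Lemma krom_translatable f : krom f -> translatable true f.
Proof.
have pos_free l : pos_lit l -> or_free l by elim: l.
elim=> [l /pos_free|l /pos_free|nabla ns ps nsP psP sz|g h _ gP _ hP].
- exact: or_free_translatable.
- exact: or_free_translatable.
- have: all or_free (map (@Neg tau P) ns ++ ps).
    rewrite all_cat all_map; apply/andP.
    by split; [apply: sub_all nsP|apply: sub_all psP].
  have: size (map (@Neg tau P) ns ++ ps) <= 2 by rewrite size_cat size_map.
  move: (_ ++ _) => s {ns ps nsP psP sz}sz_s sP.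
  elim: nabla => //=; case: s sz_s sP => [|l [|m []]] //= _.
  + by rewrite andbT; apply: or_free_translatable.
  + by rewrite andbT.
- by rewrite /= gP hP.
Qed.

End Translation.

(** * Restricting to finitely many new letters *)

Section Letters.

Variables (tau P : Type).
Implicit Types f : form tau (P + nat).

Fixpoint map_form (Q Q' : Type) (r : Q -> Q') (f : form tau Q) : form tau Q' :=
  match f with
  | Top => Top
  | Var q => Var (r q)
  | Neg g => Neg (map_form r g)
  | Or g h => Or (map_form r g) (map_form r h)
  | Dia a g => Dia a (map_form r g)
  | Box a g => Box a (map_form r g)
  end.

Fixpoint max_letter f : nat :=
  match f with
  | Var (inr n) => n
  | Top | Var _ => 0
  | Neg g | Dia _ g | Box _ g => max_letter g
  | Or g h => maxn (max_letter g) (max_letter h)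
  end.

(** [inord] sends every number above [N] to 0, so letters are kept apart only up to [N]; hence the
    bounds on [max_letter] below. *)
Definition restrict_letter (N : nat) (q : P + nat) : P + 'I_N.+1 :=
  match q with inl p => inl p | inr n => inr (inord n) end.

Lemma krom_dia_map (Q Q' : Type) (r : Q -> Q') (f : form tau Q) :
  krom_dia f -> krom_dia (map_form r f).
Proof.
have lit_map (l : form tau Q) : dia_lit l -> dia_lit (map_form r l) by elim: l.
elim=> [l /lit_map|l /lit_map|nabla ns ps nsP psP sz|g h _ gP _ hP].
- exact: krom_pos.
- exact: krom_neg.
- have -> : map_form r (boxes nabla (disj (map (@Neg tau Q) ns ++ ps))) =
      boxes nabla (disj (map (@Neg tau Q') (map (map_form r) ns) ++
                         map (map_form r) ps)).
    have -> : map (@Neg tau Q') (map (map_form r) ns) ++ map (map_form r) ps =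
        map (map_form r) (map (@Neg tau Q) ns ++ ps) by rewrite map_cat -!map_comp.
    elim: nabla => [|a nabla IH] /=; last by rewrite IH.
    by elim: (_ ++ _) => //= l [|m s] //= ->.
  apply: krom_clause; rewrite ?size_map // all_map.
    by apply: sub_all nsP.
  by apply: sub_all psP.
- exact: krom_and.
Qed.

Lemma sat_map_form (Q Q' : Type) (r : Q -> Q') (F : frame tau)
    (V : valuation F Q') (w : F) (f : form tau Q) :
  sat V w (map_form r f) <-> sat (fun u q => V u (r q)) w f.
Proof.
elim: f w => //= [f IHf|f IHf g IHg|a f IHf|a f IHf] w.
- by rewrite IHf.
- by rewrite IHf IHg.
- by split=> -[v [wv /IHf]]; exists v.
- by split=> Vf v /Vf/IHf.
Qed.

Lemma sat_restrict (F : frame tau) (V : valuation F (P + nat)) (N : nat) f w :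
  max_letter f <= N ->
  sat (fun u q => V u (match restrict_letter N q with
                       | inl p => inl p | inr i => inr (nat_of_ord i) end)) w f
  <-> sat V w f.
Proof.
elim: f w => [|[p|n]|f IHf|f IHf g IHg|a f IHf|a f IHf] w //= le_fN.
- by rewrite inordK.
- by rewrite IHf.
- by move: le_fN; rewrite geq_max => /andP[leN le'N]; rewrite IHf ?IHg.
- by split=> -[v [wv Vv]]; exists v; split=> //; apply/IHf.
- by split=> Vf v /Vf Vv; apply/IHf.
Qed.

End Letters.

(** * Computing the translation *)

Definition code_raw_letter (P : countType) (q : P + nat) : tree :=
  match q with
  | inl p => Node (code_nat 0) (code_letter p)
  | inr n => Node (code_nat 1) (code_nat n)
  end.

(** The code of a new letter records its number and not the size of the alphabet, so a program can
    output the translation without computing that size. *)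
Lemma code_restrict (tau : finType) (P : countType) N (f : form tau (P + nat)) :
  max_letter f <= N ->
  code_form (@code_letter_ext P N.+1) (map_form (@restrict_letter P N) f) =
  code_form (@code_raw_letter P) f.
Proof.
elim: f => [|[p|n]|f IHf|f IHf g IHg|a f IHf|a f IHf] //= le_fN.
- by rewrite inordK.
- by rewrite IHf.
- by move: le_fN; rewrite geq_max => /andP[leN le'N]; rewrite IHf ?IHg.
- by rewrite IHf.
- by rewrite IHf.
Qed.

Definition tNeg f := Node (code_nat 2) f.
Definition tOr f g := Node (code_nat 3) (Node f g).
Definition tDia a f := Node (code_nat 4) (Node a f).
Definition tBox a f := Node (code_nat 5) (Node a f).
Definition tname f := Node (code_nat 1) (Node (code_nat 1) (tindex f)).

Definition tiff f g :=
  Node (tOr (tNeg f) g) (Node (tOr (tNeg g) f) Leaf).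
Definition txor f g :=
  Node (tOr (tNeg f) (tNeg g)) (Node (tOr f g) Leaf).

Definition tmap_Box (a s : tree) : tree :=
  trec (fun _ => Leaf)
    (fun x => Node (tBox (tfst (tfst x)) (tfst (tsnd (tfst x)))) (tsnd (tsnd x)))
    a s.

Definition tconj : tree -> tree :=
  trec (fun _ => Node (code_nat 0) Leaf)
    (fun x => tNeg (tOr (tNeg (tfst (tsnd (tfst x)))) (tNeg (tsnd (tsnd x)))))
    Leaf.

(* The code of a formula is mapped to the triple of the codes of its definition
   and of its two assertions. *)
Definition tdefinition (m : tree) := tfst m.
Definition tassertion (b : bool) (m : tree) :=
  if b then tfst (tsnd m) else tsnd (tsnd m).

Definition ttriple d p n := Node d (Node p n).
Definition tatom n d := ttriple d (Node n d) (Node (tNeg n) d).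

(** The tag is a unary numeral, and each further [tsnd] tests whether it exceeds the next number;
    the branches follow the constructor numbers of [code_form]. *)
Definition tcase (tag top var neg or dia box : tree) : tree :=
  tif tag (tif (tsnd tag) (tif (tsnd (tsnd tag)) (tif (tsnd (tsnd (tsnd tag)))
    (tif (tsnd (tsnd (tsnd (tsnd tag)))) box dia) or) neg) var) top.

(* [f] is the code of the current formula, [m] the triple of its payload, and
   [mm] the pair of the triples of the components of its payload. *)
Definition ttranslate_step (f m mm : tree) : tree :=
  tcase (tfst f)
    (tatom (tname f) (Node (tname f) Leaf))
    (tatom (tname f)
       (tiff (tname f) (Node (code_nat 1) (Node (code_nat 0) (tsnd f)))))
    (ttriple (tcat (tdefinition m) (txor (tname f) (tname (tsnd f))))
       (tassertion false m) (tassertion true m))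
    (ttriple Leaf
       (Node (tOr (tname (tfst (tsnd f))) (tname (tsnd (tsnd f))))
          (tcat (tdefinition (tfst mm)) (tdefinition (tsnd mm))))
       (tcat (tassertion false (tfst mm)) (tassertion false (tsnd mm))))
    (tatom (tname f)
       (tcat (tmap_Box (tfst (tsnd f)) (tdefinition (tsnd mm)))
          (tiff (tname f) (tDia (tfst (tsnd f)) (tname (tsnd (tsnd f)))))))
    (let d := tcat
       (tmap_Box (tfst (tsnd f))
          (tcat (tdefinition (tsnd mm))
             (txor (tname (tNeg (tsnd (tsnd f)))) (tname (tsnd (tsnd f))))))
       (txor (tname f)
          (tDia (tfst (tsnd f)) (tname (tNeg (tsnd (tsnd f)))))) in
     ttriple d (tmap_Box (tfst (tsnd f)) (tassertion true (tsnd mm)))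
       (Node (tNeg (tname f)) d)).

(* Recursion reaches the components of a payload one level too early for its
   results to be visible at the formula, so each result carries along the
   results of its two children. *)
Definition ttranslate : tree -> tree :=
  trec (fun _ => Leaf)
    (fun x => Node
      (ttranslate_step (tsnd (tfst x)) (tfst (tsnd (tsnd x)))
         (tsnd (tsnd (tsnd x))))
      (Node (tfst (tfst (tsnd x))) (tfst (tsnd (tsnd x)))))
    Leaf.

Lemma computable_name f : computable f -> computable (fun x => tname (f x)).
Proof. by move=> fP; computability; apply: computable_index. Qed.

Lemma computable_map_Box f g :
  computable f -> computable g -> computable (fun x => tmap_Box (f x) (g x)).
Proof. by move=> fP gP; apply: computable_rec; computability. Qed.

Lemma computable_conj f : computable f -> computable (fun x => tconj (f x)).
Proof. by move=> fP; apply: computable_rec; computability. Qed.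

Lemma computable_translate : computable ttranslate.
Proof.
apply: computable_rec; [exact: computable_const| |exact: computable_const
  |exact: computable_id].
rewrite /ttranslate_step /tcase /tatom /ttriple /tiff /txor /tNeg /tOr /tDia
  /tdefinition /tassertion.
by repeat first [apply: computable_name | apply: computable_map_Box
  | apply: computable_cat | computability_step].
Qed.

(** * Correctness of the computation on codes *)

Section Codes.

Variables (tau : finType) (P : countType).

Let code := code_form (tau := tau) (@code_raw_letter P).

Definition code_seq (s : seq (form tau (P + nat))) : tree :=
  foldr (fun f t => Node (code f) t) Leaf s.

Lemma tcatE s t : tcat (code_seq s) (code_seq t) = code_seq (s ++ t).
Proof. by rewrite /tcat; elim: s => //= f s ->. Qed.

Lemma tmap_BoxE a s :
  tmap_Box (code_nat (pickle a)) (code_seq s) = code_seq (map (Box a) s).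
Proof. by rewrite /tmap_Box; elim: s => //= f s ->. Qed.

Lemma tconjE s : tconj (code_seq s) = code (conjunction s).
Proof. by rewrite /tconj; elim: s => //= f s ->. Qed.

Lemma tnameE f : tname (code_form (@code_letter P) f) = code (name f).
Proof. by rewrite /tname tindexE. Qed.

Lemma tiffE f g : tiff (code f) (code g) = code_seq (iff_clauses f g).
Proof. by []. Qed.

Lemma txorE f g : txor (code f) (code g) = code_seq (xor_clauses f g).
Proof. by []. Qed.

(** For each head constructor the recursion unfolds by conversion; the rewriting then replaces
    operations on codes by the operations on clause lists that they mirror. *)
Lemma ttranslateE (f : form tau P) :
  tfst (ttranslate (code_form (@code_letter P) f)) =
  ttriple (code_seq (definition_of f))
    (code_seq (assertion true f)) (code_seq (assertion false f)).
Proof.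
pose c := code_form (tau := tau) (@code_letter P).
pose m g := tfst (ttranslate (c g)); rewrite -[LHS]/(m f).
pose D g := tdefinition (m g); pose A b g := tassertion b (m g).
elim: f => [|p|g IHg|g IHg h IHh|a g IHg|a g IHg].
- rewrite -[m _]/(tatom (tname (c Top)) (Node (tname (c Top)) Leaf)).
  by rewrite tnameE.
- rewrite -[m _]/(tatom (tname (c (Var p)))
    (tiff (tname (c (Var p))) (code (Var (inl p))))).
  by rewrite tnameE tiffE.
- rewrite -[m _]/(ttriple (tcat (D g) (txor (tname (c (Neg g))) (tname (c g))))
    (A false g) (A true g)).
  by rewrite !tnameE /D /A IHg txorE tcatE.
- rewrite -[m _]/(ttriple Leaf
    (Node (tOr (tname (c g)) (tname (c h))) (tcat (D g) (D h)))
    (tcat (A false g) (A false h))).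
  by rewrite !tnameE /D /A IHg IHh !tcatE.
- rewrite -[m _]/(tatom (tname (c (Dia a g)))
    (tcat (tmap_Box (code_nat (pickle a)) (D g))
      (tiff (tname (c (Dia a g))) (tDia (code_nat (pickle a)) (tname (c g)))))).
  rewrite !tnameE /D IHg tmap_BoxE -[tDia _ _]/(code (Dia a (name g))).
  by rewrite tiffE tcatE.
- pose d := tcat
    (tmap_Box (code_nat (pickle a))
      (tcat (D g) (txor (tname (c (Neg g))) (tname (c g)))))
    (txor (tname (c (Box a g)))
      (tDia (code_nat (pickle a)) (tname (c (Neg g))))).
  have dE : d = code_seq (definition_of (Box a g)).
    rewrite /d !tnameE /D IHg txorE tcatE tmap_BoxE.
    by rewrite -[tDia _ _]/(code (Dia a (name (Neg g)))) txorE tcatE.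
  rewrite -[m _]/(ttriple d (tmap_Box (code_nat (pickle a)) (A true g))
    (Node (tNeg (tname (c (Box a g)))) d)).
  by rewrite dE tnameE /A IHg tmap_BoxE.
Qed.

End Codes.

(** * Comparing the two fragments *)

Section Comparison.

Variables (tau : finType) (P : countType).

Definition translation (f : form tau P) : form tau (P + nat) :=
  conjunction (assertion true f).

(** One translation serves both directions of the equivalence: it accepts every Krom formula and
    always lands in the diamond fragment, which both languages include. *)
Lemma translation_strong_le (L L' : language tau) :
  (forall f : form tau P, L P f -> krom f) ->
  (forall Q (f : form tau Q), krom_dia f -> L' Q f) ->
  strong_le P L L'.
Proof.
(* New letters are numbered from 0, hence the successor of the largest number. *)
move=> LK KL'; exists (fun f => (max_letter (translation f)).+1).
exists (fun f => map_form (@restrict_letter P _) (translation f)); split.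
- have [p pP] : computable (fun x => tconj (tassertion true (tfst (ttranslate x)))).
    apply: computable_conj; computability; exact: computable_translate.
  exists p => f _; rewrite code_restrict //.
  by have := pP (code_form (@code_letter P) f); rewrite ttranslateE tconjE.
- move=> f _; apply/KL'/krom_dia_map/krom_dia_conj; exact: clauses_assertion.
move=> f /LK/krom_translatable fP F V w; split=> [Vf|[V' [VV' V'f]]].
  exists (fun u q => naming_valuation V u
    match q with inl p => inl p | inr i => inr (nat_of_ord i) end).
  split=> //; apply/sat_map_form/sat_restrict => //.
  by apply/sat_conj/naming_assertion.
(* Pulled back along [restrict_letter], [V'] is a valuation on [P + nat] that still extends [V]. *)
move/sat_map_form/sat_conj: V'f.
by apply: (@assertion_sound _ _ _ _ _ _ w true).
Qed.

(** * A pair of models for the weak order *)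

Inductive dead_end_world : Type := Root | Loop | DeadEnd.

(** Both frames have the same three worlds, and all labels share one relation; [dead] only switches
    the edge from [Root] to [DeadEnd]. *)
Definition dead_end_frame (dead : bool) : frame tau :=
  @Frame tau dead_end_world (inhabits Root)
    (fun _ u v =>
       v = Loop /\ u <> DeadEnd \/ [/\ dead, u = Root & v = DeadEnd]).

Definition dead_end_valuation dead : valuation (dead_end_frame dead) P :=
  fun u _ => u <> DeadEnd.

(** [Loop] witnesses every diamond, with or without the extra edge. *)
Lemma sat_dia_lit dead (l : form tau P) (u : dead_end_frame dead) :
  dia_lit l -> u <> DeadEnd -> sat (@dead_end_valuation dead) u l.
Proof.
elim: l u => //= a l IHl u lP uD.
by exists Loop; split; [left|apply: IHl].
Qed.

(** Away from [DeadEnd] literals keep their values, and removing an edge only leaves boxes fewer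
    successors to check. *)
Lemma krom_dia_remove_dead_end (f : form tau P) :
  krom_dia f ->
  sat (F := dead_end_frame true) (@dead_end_valuation true) Root f ->
  sat (F := dead_end_frame false) (@dead_end_valuation false) Root f.
Proof.
pose V dead := @dead_end_valuation dead.
pose signed (g : form tau P) := if g is Neg l then dia_lit l else dia_lit g.
have sat_signed g (u : dead_end_world) : signed g -> u <> DeadEnd ->
    sat (F := dead_end_frame true) (V true) u g ->
    sat (F := dead_end_frame false) (V false) u g.
  case: g => [|p|l|l m|a l|a l] gP uD // Vg; try exact: sat_dia_lit.
  by case: Vg; apply: sat_dia_lit.
elim=> [l lP|l lP|nabla ns ps nsP psP _|g h _ IHg _ IHh].
- by move=> _; apply: sat_dia_lit.
- exact: sat_signed.
- have: all signed (map (@Neg tau P) ns ++ ps).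
    rewrite all_cat all_map; apply/andP; split; first by apply: sub_all nsP.
    by apply: sub_all psP => -[].
  (* The claim is generalized from [Root] to any world other than [DeadEnd], because the first box
     of a prefix leads to [Loop]. *)
  move: (_ ++ _) => s sP; have: Root <> DeadEnd by [].
  elim: nabla Root => [|a nabla IH] u uD /=; last first.
    by move=> Vs v [[-> _]|[]] //; apply: IH => //; apply: Vs; left.
  elim: s sP => [_|g [|h s] IHs /andP[gP sP]]; first by case.
    exact: sat_signed.
  by case=> [/(sat_signed _ _ gP uD)|/(IHs sP)]; [left|right].
- by move=> /sat_And[/IHg Vg /IHh Vh]; apply/sat_And.
Qed.

End Comparison.

Theorem theorem6 (tau : finType) (P : countType) :
  strong_equiv P (@krom_dia tau) (@krom tau) /\
  (0 < #|tau| -> weak_lt P (@krom_dia tau) (@krom tau)).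
Proof.
split.
  split; apply: translation_strong_le => //; by move=> *; apply: krom_dia_krom.
case/card_gt0P=> a _; split.
  exists id; split=> //; last exact: krom_dia_krom.
  by exists PId => f _; constructor.
case=> _ [t [_ tP tE]].
(* True at [Root] if [DeadEnd], which has no successors, is visible; false otherwise, as [Loop] is
   then the only successor and sees itself. *)
pose f : form tau P := Neg (Box a (Dia a Top)).
have fP : krom f by apply: krom_neg.
have /(tE f fP) : sat (F := dead_end_frame tau true)
    (@dead_end_valuation tau P true) Root f.
  move=> /= /(_ DeadEnd) []; first by right.
  by move=> v [[[_ /(_ erefl)]|[_]]].
(* The translation [t f] survives the removal of the edge, so [f] would have to survive it too. *)
move/(krom_dia_remove_dead_end (tP f fP))/(tE f fP); case=> v [[-> _]|[]] //.
by exists Loop; split=> //; left.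
Qed.
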